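(* Let $R$ be a commutative ring containing a field of positive characteristic $p$, let $X_{\mathrm{frob}}=\operatorname{Spec} R$ be endowed with the Frobenius topology, and let $M$ be an $R$-module with corresponding Frobenius sheaf $M_{\mathrm{frob}}$ on $X_{\mathrm{frob}}$. Then $\check H^k(X_{\mathrm{frob}},M_{\mathrm{frob}})=0$ for $k\ge1$, and in particular $H^1(X_{\mathrm{frob}},M_{\mathrm{frob}})=0$.
   Context: For a scheme $U$ of characteristic $p$ let ${}^eU\to U$ be the $e$-th iterate of the absolute Frobenius morphism. A finite morphism $V\to U$ of finite type of schemes of characteristic $p$ is a finite Frobenius cover if there are $e\in\mathbb N$ and a factorization ${}^eU\to V\to U$ of the $e$-th iterate of the absolute Frobenius such that ${}^eU\to V$ is surjective. Frobenius topology on a scheme $X$ of characteristic $p$: the category consists of schemes over $X$ where all morphisms (including the structural morphisms to $X$) are finite Frobenius covers; each such single morphism is a covering. $M_{\mathrm{frob}}$ is the sheafification of the presheaf $\operatorname{Spec} S\mapsto M\otimes_RS$. $H^k$ is derived functor cohomology of the global section functor on abelian sheaves. $\check H^k(X,\mathcal F)$ is the colimit over all coverings $Y\to X$ (ordered by refinement) of the homology of the Čech complex $\Gamma(Y,\mathcal F)\to\Gamma(Y\times_XY,\mathcal F)\to\Gamma(Y\times_XY\times_XY,\mathcal F)\to\cdots$ (alternating sums of restrictions along projections). *)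

(* Defs.v *)
From HB Require Import structures.
From mathcomp Require Import all_boot ssralg ring_quotient generic_quotient.
From mathcomp Require Import boolp classical_sets.
Set Implicit Arguments.
Unset Strict Implicit.
Unset Printing Implicit Defensive.
Import GRing.Theory.

(* The Frobenius site of the affine scheme X = Spec R.  An affine morphism
   Spec T -> Spec S is given by its ring map S -> T.  A scheme that is finite
   over an affine scheme is affine, so the schemes finite over X are exactly the
   spectra of the finite R-algebras, and the whole site lives in commutative
   algebra. *)

Local Open Scope ring_scope.
Local Open Scope quotient_scope.

(* Spec f is finite; it is then automatically of finite type. *)
Definition finite_hom (S T : comNzRingType) (f : {rmorphism S -> T}) : Prop :=
  exists (n : nat) (t : 'I_n -> T),
    forall y, exists c : 'I_n -> S, y = \sum_(i < n) f (c i) * t i.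

(* Spec g : Spec S -> Spec T is surjective. *)
Definition spec_surjective (T S : comNzRingType) (g : {rmorphism T -> S}) : Prop :=
  forall Q : prime_idealr T, exists P : prime_idealr S,
    forall x : T, (x \in (Q : pred T)) = (g x \in (P : pred S)).

(* Spec f : V = Spec T -> U = Spec S is a finite Frobenius cover: the e-th
   Frobenius x |-> x ^+ (p ^ e) of S factors as S -f-> T -g-> S, that is
   ^eU -> V -> U, and Spec g : ^eU -> V is surjective. *)
Definition frobenius_cover (p : nat) (S T : comNzRingType)
    (f : {rmorphism S -> T}) : Prop :=
  finite_hom f /\
  exists (e : nat) (g : {rmorphism T -> S}),
    (forall x, g (f x) = x ^+ (p ^ e)) /\ spec_surjective g.

Lemma mk_prime_idealr (S : comNzRingType) (P : {pred S}) :
  idealr_closed P -> prime_idealr_closed P ->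
  exists P' : prime_idealr S, (P' : pred S) =i P.
Proof.
move=> h1 h2.
pose P0 : S -> bool := P.
pose m1 := isIdealr.Build S P0 h1.
pose m2 := isPrimeIdealrClosed.Build S P0 h2.
pose P' : prime_idealr S := HB.pack P0 m1 m2.
by exists P'.
Qed.

Section Charp.
Variables (p : nat).

Lemma exprDp (S : comNzRingType) (pS : p \in [pchar S]) (x y : S) k :
  (x + y) ^+ (p ^ k) = x ^+ (p ^ k) + y ^+ (p ^ k).
Proof.
elim: k => [|k IH]; first by rewrite !expr1.
by rewrite !expnSr !exprM IH -!(pFrobenius_autE pS) rmorphD.
Qed.

Lemma exprBp (S : comNzRingType) (pS : p \in [pchar S]) (x y : S) k :
  (x - y) ^+ (p ^ k) = x ^+ (p ^ k) - y ^+ (p ^ k).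
Proof.
elim: k => [|k IH]; first by rewrite !expr1.
by rewrite !expnSr !exprM IH -!(pFrobenius_autE pS) rmorphB.
Qed.

Lemma exprSump (S : comNzRingType) (pS : p \in [pchar S]) (I : finType) (F : I -> S) k :
  (\sum_i F i) ^+ (p ^ k) = \sum_i F i ^+ (p ^ k).
Proof.
have p0 : (p ^ k != 0)%N.
  by rewrite -lt0n expn_gt0 prime_gt0 // (pcharf_prime pS).
apply: (big_morph (fun x : S => x ^+ (p ^ k))) => [x y|]; first exact: exprDp.
by rewrite expr0n (negPf p0).
Qed.

Section Frob.
Variables (S T : comNzRingType) (pS : p \in [pchar S]) (g : {rmorphism T -> S}) (k : nat).
Definition frobenius_comp (x : T) : S := g x ^+ (p ^ k).
Lemma frobenius_comp_zmod : zmod_morphism frobenius_comp.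
Proof. by move=> x y; rewrite /frobenius_comp rmorphB exprBp. Qed.
Lemma frobenius_comp_monoid : monoid_morphism frobenius_comp.
Proof.
split=> [|x y]; rewrite /frobenius_comp ?rmorph1 ?expr1n //.
by rewrite rmorphM exprMn.
Qed.
Lemma frobenius_comp_rmorph :
  exists h : {rmorphism T -> S}, forall x, h x = g x ^+ (p ^ k).
Proof.
pose m1 := GRing.isZmodMorphism.Build T S frobenius_comp frobenius_comp_zmod.
pose m2 := GRing.isMonoidMorphism.Build T S frobenius_comp frobenius_comp_monoid.
pose h : {rmorphism T -> S} := HB.pack frobenius_comp m1 m2.
by exists h.
Qed.
End Frob.

Lemma prime_avoid (T : comNzRingType) (t : T) : (forall k, t ^+ k != 0) ->
  exists Q : prime_idealr T, t \notin (Q : pred T).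
Proof.
move=> tk.
pose Z : set (set T) := fun A =>
  (forall a u v, A u -> A v -> A (a * u + v)) /\ forall k, ~ A (t ^+ k).
have [F FZ Ftot|A [[A1 A2] Amax]] := @Zorn_bigcup T Z.
  split=> [a u v [X FX Xu] [Y FY Yv]|k [X FX Xt]].
    have [XY|YX] := Ftot _ _ FX FY.
      by exists Y => //; apply: (FZ _ FY).1 => //; apply: XY.
    by exists X => //; apply: (FZ _ FX).1 => //; apply: YX.
  by apply: (FZ _ FX).2 Xt.
have A0 : A 0.
  have [[u Au]|nA] := pselect (exists u, A u).
    by rewrite -(addNr u) -mulN1r; apply: A1.
  exfalso; apply: (Amax (fun x => x = 0)).
    split; last by move=> /(_ 0 erefl) h; apply: nA; exists 0.
    by move=> x Ax; case: nA; exists x.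
  split=> [a u v -> ->|k /eqP]; first by rewrite mulr0 add0r.
  by rewrite (negPf (tk k)).
have AM a u : A u -> A (a * u) by move=> Au; rewrite -[a * u]addr0; apply: A1.
have AD u v : A u -> A v -> A (u + v) by move=> Au Av; rewrite -[u]mul1r; apply: A1.
have out x : ~ A x -> exists k r a, A a /\ t ^+ k = a + r * x.
  move=> nAx; pose B := fun y => exists r a, A a /\ y = a + r * x.
  have AB : (A `<` B)%classic.
    split.
      by move=> y Ay; exists 0, y; split=> //; rewrite mul0r addr0.
    move=> /(_ x); apply: (contra_not _ nAx) => h; apply: h.
    by exists 1, 0; rewrite mul1r add0r.
  have nZB := Amax _ AB.
  apply: contrapT => nk; apply: nZB; split.
    move=> a u v [r [b [Ab ->]]] [s [c [Ac ->]]].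
    exists (a * r + s), (a * b + c); split; first exact: A1.
    by rewrite mulrDr mulrDl !mulrA addrACA.
  by move=> k [r [a [Aa e]]]; apply: nk; exists k, r, a.
pose Q : {pred T} := [pred x | `[< A x >]].
have QE x : (x \in Q) = `[< A x >] by [].
have [|u v|Q' Q'E] := @mk_prime_idealr T Q.
- split; rewrite ?QE; first exact/asboolP.
    by apply/asboolP => /(A2 0%N).
  move=> a u v; rewrite !QE => /asboolP Au /asboolP Av; apply/asboolP.
  exact: A1.
- rewrite !QE => /asboolP Auv.
  case: (asboolP (A u)) => [//|nu] /=.
  apply/asboolP; apply: contrapT => nv.
  have [k [r [a [Aa ek]]]] := out _ nu.
  have [l [s [b [Ab el]]]] := out _ nv.
  apply: (A2 (k + l)%N); rewrite exprD ek el mulrDl mulrC [X in A (_ + X)]mulrDr.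
  apply: (AD); first exact: AM.
  apply: AD; first exact: AM.
  by rewrite mulrACA; apply: AM.
- by exists Q'; rewrite Q'E QE; apply/asboolP => h; apply: (A2 1%N); rewrite expr1.
Qed.

Lemma ker_nil (T S : comNzRingType) (g : {rmorphism T -> S}) :
  spec_surjective g -> forall t, g t = 0 -> exists k, t ^+ k = 0.
Proof.
move=> gs t gt0; apply: contrapT => nk.
have [k|Q tQ] := @prime_avoid T t.
  by apply/negP => /eqP h; apply: nk; exists k.
have [P PE] := gs Q; move: tQ; rewrite PE gt0.
by rewrite idealr0.
Qed.

(* Given g \o f = Frob^e, this characterizes the surjectivity of Spec g; see
   spec_frob_inv and frob_inv_spec. *)
Definition frob_inv (S T : comNzRingType) (f : S -> T) (g : T -> S) e :=
  forall t, exists k, f (g t) ^+ (p ^ k) = t ^+ (p ^ (e + k)).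

Lemma spec_frob_inv (S T : comNzRingType) (pS : p \in [pchar S])
    (f : {rmorphism S -> T}) (g : {rmorphism T -> S}) e :
  (forall x, g (f x) = x ^+ (p ^ e)) -> spec_surjective g -> frob_inv f g e.
Proof.
move=> gf gs t.
have pT : p \in [pchar T] := rmorph_pchar f pS.
have [|m hm] := ker_nil gs (t := f (g t) - t ^+ (p ^ e)).
  by rewrite rmorphB gf rmorphXn subrr.
exists m; apply/eqP; rewrite -subr_eq0 expnD exprM -exprBp //.
have p1 := prime_gt1 (pcharf_prime pS).
have mp : (m <= p ^ m)%N by apply/ltnW/ltn_expl.
by rewrite -(subnK mp) exprD hm mulr0.
Qed.

Lemma prime_idealrX (T : comNzRingType) (Q : prime_idealr T) (x : T) n : (0 < n)%N ->
  (x ^+ n \in (Q : pred T)) = (x \in (Q : pred T)).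
Proof.
case: n => // n _; elim: n => [|n IH]; first by rewrite expr1.
by rewrite exprS prime_idealrM IH orbb.
Qed.

Lemma frob_inv_spec (S T : comNzRingType) (pS : p \in [pchar S])
    (f : {rmorphism S -> T}) (g : {rmorphism T -> S}) e :
  frob_inv f g e -> spec_surjective g.
Proof.
move=> fi Q; pose P : {pred S} := [pred s | f s \in (Q : pred T)].
have [|u v|P' P'E] := @mk_prime_idealr S P.
- split; rewrite ?inE ?rmorph0 ?rmorph1 ?idealr0 ?idealr1 //.
  by move=> a u v; rewrite !inE => uQ vQ; rewrite rmorphD rmorphM rpredD // idealMr.
- by rewrite !inE rmorphM prime_idealrM.
exists P' => x; rewrite P'E !inE.
have p0 := prime_gt0 (pcharf_prime pS).
have [k hk] := fi x.
rewrite -(@prime_idealrX _ Q x (p ^ (e + k))) ?expn_gt0 ?p0 // -hk.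
by rewrite prime_idealrX // expn_gt0 p0.
Qed.

Lemma finite_homP (S T : comNzRingType) (f : {rmorphism S -> T}) (I : finType) (t : I -> T) :
  (forall y, exists c : I -> S, y = \sum_i f (c i) * t i) -> finite_hom f.
Proof.
move=> h; exists #|I|, (fun i => t (enum_val i)) => y.
have [c ->] := h y; exists (fun i => c (enum_val i)).
by rewrite (reindex (@enum_val I predT)) //=; apply: onW_bij; apply: enum_val_bij.
Qed.

Lemma frobenius_cover_id (S : comNzRingType) : frobenius_cover p (idfun : {rmorphism S -> S}).
Proof.
split.
  exists 1%N, (fun=> 1) => y; exists (fun=> y).
  by rewrite big_ord1 mulr1.
by exists 0%N, idfun; split=> // Q; exists Q.
Qed.

Lemma frobenius_cover_comp (S T W : comNzRingType)
    (f : {rmorphism S -> T}) (g : {rmorphism T -> W}) :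
  frobenius_cover p f -> frobenius_cover p g -> frobenius_cover p (g \o f).
Proof.
case=> [[n [t ht]] [e [f' [ff' sf]]]] [[m [w hw]] [e' [g' [gg' sg]]]]; split.
  apply: (@finite_homP _ _ _ ('I_m * 'I_n)%type (fun ij => g (t ij.2) * w ij.1)) => y.
  have [c ->] := hw y.
  have /choice [b hb] : forall i : 'I_m, exists b : 'I_n -> S, c i = \sum_j f (b j) * t j.
    by move=> i; apply: ht.
  exists (fun ij => b ij.1 ij.2); rewrite -(pair_bigA _ (fun i j => (g \o f) (b i j) * (g (t j) * w i))) /=.
  apply: eq_bigr => i _; rewrite hb rmorph_sum big_distrl /=.
  by apply: eq_bigr => j _; rewrite rmorphM mulrA.
exists (e' + e)%N, (f' \o g' : {rmorphism W -> S}); split.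
  by move=> x; rewrite /= gg' rmorphXn ff' expnD mulnC exprM.
move=> Q; have [P PE] := sg Q; have [O OE] := sf P.
by exists O => x; rewrite PE OE.
Qed.

Lemma alg_hom_cover (R S T : comNzRingType) (pR : p \in [pchar R])
    (a : {rmorphism R -> S}) (b : {rmorphism R -> T}) (h : {rmorphism S -> T}) :
  frobenius_cover p a -> frobenius_cover p b -> (forall r, h (a r) = b r) ->
  frobenius_cover p h.
Proof.
move=> [[n [s hs]] [e1 [g1 [ga sa]]]] [[m [t ht]] [e2 [g2 [gb sb]]]] hab.
have pS := rmorph_pchar a pR; have pT := rmorph_pchar b pR.
have ia := spec_frob_inv pR ga sa; have ib := spec_frob_inv pR gb sb.
split.
  exists m, t => y; have [c ->] := ht y; exists (fun i => a (c i)).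
  by apply: eq_bigr => i _; rewrite hab.
have loc x : exists k, forall j, (k <= j)%N ->
    a (g2 (h x)) ^+ (p ^ j) = x ^+ (p ^ (e2 + j)).
  have [k hk] := ia x; exists (e1 + k)%N => j lej.
  have E : a (g2 (h x)) ^+ (p ^ (e1 + k)) = x ^+ (p ^ (e1 + k)) ^+ (p ^ e2).
    by rewrite -[LHS]rmorphXn -[in LHS]rmorphXn -[in LHS]rmorphXn -hk
               -(rmorphXn a) hab gb rmorphXn.
  rewrite -(subnKC lej) expnD exprM E -!exprM -!expnD.
  by rewrite addnCA.
have /choice [K hK] : forall i : 'I_n, exists k, forall j, (k <= j)%N ->
    a (g2 (h (s i))) ^+ (p ^ j) = s i ^+ (p ^ (e2 + j)) by move=> i; apply: (loc).
pose k := (\max_i K i)%N.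
have [psi psiE] := frobenius_comp_rmorph pS (a \o g2 : {rmorphism T -> S}) k.
exists (e2 + k)%N, psi.
have psih x : psi (h x) = x ^+ (p ^ (e2 + k)).
  have [c ->] := hs x; rewrite rmorph_sum rmorph_sum exprSump //.
  apply: eq_bigr => i _; rewrite !rmorphM hab exprMn; congr (_ * _).
    by rewrite psiE /= gb -rmorphXn -exprM -expnD rmorphXn.
  by rewrite psiE /= hK // /k; apply: leq_bigmax.
split=> //; apply: (@frob_inv_spec _ _ pS h) => y.
have [l hl] := ib y; exists l.
by rewrite psiE /= rmorphXn hab exprAC hl -exprM -expnD addnAC.
Qed.

End Charp.

Section TensorPower.
Variables (p : nat) (S T : comNzRingType) (f : {rmorphism S -> T}) (n : nat).

(* The tensor power T ^(x) (n+1) over S, i.e. the (n+1)-fold coproduct of the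
   S-algebra T.  A finite formal sum of pure tensors a_0 (x) ... (x) a_n is a
   sequence of functions a; two such sums are identified when all families of
   n+1 ring maps T -> A agreeing on S give them the same image.  tinj i are the
   coprojections and tlift is the universal property. *)
Record cofamily := Cofamily {
  cf_ring : comNzRingType;
  cf_map :> 'I_n.+1 -> {rmorphism T -> cf_ring};
  cf_compat : forall i j s, cf_map i (f s) = cf_map j (f s) }.

Definition tensor_eval (c : cofamily) (w : seq {ffun 'I_n.+1 -> T}) : cf_ring c :=
  \sum_(a <- w) \prod_i c i (a i).

Definition tensor_eq (w w' : seq {ffun 'I_n.+1 -> T}) : bool :=
  `[< forall c, tensor_eval c w = tensor_eval c w' >].

Lemma tensor_eq_refl : reflexive tensor_eq.
Proof. by move=> w; apply/asboolP. Qed.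
Lemma tensor_eq_sym : symmetric tensor_eq.
Proof. by move=> w w'; apply/asboolP/asboolP => h c; rewrite h. Qed.
Lemma tensor_eq_trans : transitive tensor_eq.
Proof. by move=> y x z /asboolP h /asboolP h'; apply/asboolP => c; rewrite h h'. Qed.

Canonical tensor_eq_equiv :=
  EquivRel tensor_eq tensor_eq_refl tensor_eq_sym tensor_eq_trans.

(* fc is a parameter of the type because it makes the tensor power nonzero. *)
Hypothesis fc : frobenius_cover p f.

Definition tensor_power of frobenius_cover p f : Type := {eq_quot tensor_eq}.
Local Notation W := (tensor_power fc).
HB.instance Definition _ := Choice.on W.

Definition tcls (w : seq {ffun 'I_n.+1 -> T}) : W := \pi_({eq_quot tensor_eq}) w.
Definition trepr (x : W) : seq {ffun 'I_n.+1 -> T} := repr (x : {eq_quot tensor_eq}).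
Definition tlift (c : cofamily) (x : W) : cf_ring c := tensor_eval c (trepr x).

Lemma tliftE c w : tlift c (tcls w) = tensor_eval c w.
Proof.
suff /asboolP : tensor_eq (trepr (tcls w)) w by apply.
have := reprK (tcls w : {eq_quot tensor_eq}).
by move/eqP; rewrite /tcls /trepr eqquotE.
Qed.

Lemma tlift_inj x y : (forall c, tlift c x = tlift c y) -> x = y.
Proof.
move=> h; rewrite -[x](@reprK _ {eq_quot tensor_eq}) -[y](@reprK _ {eq_quot tensor_eq}).
by apply/eqP; rewrite eqquotE; apply/asboolP.
Qed.

Definition tadd (x y : W) : W := tcls (trepr x ++ trepr y).
Definition topp (x : W) : W :=
  tcls [seq [ffun i => if i == ord0 then - a i else a i] | a : {ffun _ -> _} <- trepr x].
Definition tmul (x y : W) : W :=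
  tcls [seq [ffun i => a i * b i] | a : {ffun _ -> _} <- trepr x, b : {ffun _ -> _} <- trepr y].
Definition tzero : W := tcls [::].
Definition tone : W := tcls [:: [ffun=> 1]].

Lemma tlift_add c x y : tlift c (tadd x y) = tlift c x + tlift c y.
Proof. by rewrite /tadd tliftE /tensor_eval big_cat. Qed.
Lemma tlift_opp c x : tlift c (topp x) = - tlift c x.
Proof.
rewrite /topp tliftE /tensor_eval big_map -sumrN; apply: eq_bigr => a _.
rewrite !big_ord_recl ffunE eqxx rmorphN mulNr; congr (- (_ * _)).
by apply: eq_bigr => i _; rewrite ffunE.
Qed.
Lemma tlift_mul c x y : tlift c (tmul x y) = tlift c x * tlift c y.
Proof.
rewrite /tmul tliftE /tensor_eval big_allpairs_dep big_distrl /=.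
apply: eq_bigr => a _; rewrite big_distrr /=; apply: eq_bigr => b _.
by rewrite -big_split; apply: eq_bigr => i _; rewrite ffunE rmorphM.
Qed.
Lemma tlift_zero c : tlift c tzero = 0.
Proof. by rewrite tliftE /tensor_eval big_nil. Qed.
Lemma tlift_one c : tlift c tone = 1.
Proof. by rewrite tliftE /tensor_eval big_seq1 big1 // => i _; rewrite ffunE rmorph1. Qed.

Let tE := (tlift_add, tlift_opp, tlift_mul, tlift_zero, tlift_one).

Lemma taddA : associative tadd.
Proof. by move=> x y z; apply: tlift_inj => c; rewrite !tE addrA. Qed.
Lemma taddC : commutative tadd.
Proof. by move=> x y; apply: tlift_inj => c; rewrite !tE addrC. Qed.
Lemma tadd0 : left_id tzero tadd.
Proof. by move=> x; apply: tlift_inj => c; rewrite !tE add0r. Qed.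
Lemma taddN : left_inverse tzero topp tadd.
Proof. by move=> x; apply: tlift_inj => c; rewrite !tE addNr. Qed.
Lemma tmulA : associative tmul.
Proof. by move=> x y z; apply: tlift_inj => c; rewrite !tE mulrA. Qed.
Lemma tmulC : commutative tmul.
Proof. by move=> x y; apply: tlift_inj => c; rewrite !tE mulrC. Qed.
Lemma tmul1 : left_id tone tmul.
Proof. by move=> x; apply: tlift_inj => c; rewrite !tE mul1r. Qed.
Lemma tmulD : left_distributive tmul tadd.
Proof. by move=> x y z; apply: tlift_inj => c; rewrite !tE mulrDl. Qed.

HB.instance Definition _ := GRing.isZmodule.Build W taddA taddC tadd0 taddN.

Lemma tone_neq0 : tone != 0.
Proof.
have [_ [e [g _]]] := fc; apply/eqP => h.
pose c : cofamily := @Cofamily S (fun=> g) (fun _ _ _ => erefl).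
by have /eqP := congr1 (tlift c) h; rewrite tlift_one tlift_zero oner_eq0.
Qed.

HB.instance Definition _ :=
  GRing.Zmodule_isComNzRing.Build W tmulA tmulC tmul1 tmulD tone_neq0.

Lemma tlift_is_zmod c : zmod_morphism (tlift c : W -> cf_ring c).
Proof. by move=> x y; rewrite -[x - y]/(tadd x (topp y)) !tE. Qed.
Lemma tlift_is_monoid c : monoid_morphism (tlift c : W -> cf_ring c).
Proof. by split=> [|x y]; rewrite -?[1]/tone -?[x * y]/(tmul x y) !tE. Qed.
HB.instance Definition _ c := GRing.isZmodMorphism.Build W (cf_ring c) (tlift c) (tlift_is_zmod c).
HB.instance Definition _ c := GRing.isMonoidMorphism.Build W (cf_ring c) (tlift c) (tlift_is_monoid c).

Definition tinj (i : 'I_n.+1) (x : T) : W :=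
  tcls [:: [ffun j => if j == i then x else 1]].

Lemma tlift_inj_E c i x : tlift c (tinj i x) = c i x.
Proof.
rewrite tliftE /tensor_eval big_seq1 (bigD1 i) //= ffunE eqxx big1 ?mulr1 //.
by move=> j /negPf ji; rewrite ffunE ji rmorph1.
Qed.

Lemma tinj_is_zmod i : zmod_morphism (tinj i).
Proof. by move=> x y; apply: tlift_inj => c; rewrite rmorphB /= !tlift_inj_E rmorphB. Qed.
Lemma tinj_is_monoid i : monoid_morphism (tinj i).
Proof.
split=> [|x y]; apply: tlift_inj => c; first by rewrite tlift_inj_E !rmorph1.
by rewrite rmorphM /= !tlift_inj_E rmorphM.
Qed.
HB.instance Definition _ i := GRing.isZmodMorphism.Build T W (tinj i) (tinj_is_zmod i).
HB.instance Definition _ i := GRing.isMonoidMorphism.Build T W (tinj i) (tinj_is_monoid i).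

Lemma tinj_compat i j s : tinj i (f s) = tinj j (f s).
Proof. by apply: tlift_inj => c; rewrite !tlift_inj_E (cf_compat c i j). Qed.

Lemma tclsE w : tcls w = \sum_(a <- w) \prod_i tinj i (a i).
Proof.
apply: tlift_inj => c; rewrite rmorph_sum tliftE; apply: eq_bigr => a _.
by rewrite rmorph_prod; apply: eq_bigr => i _; rewrite /= tlift_inj_E.
Qed.

Lemma tgen (x : W) : exists w : seq {ffun 'I_n.+1 -> T}, x = \sum_(a <- w) \prod_i tinj i (a i).
Proof. by exists (trepr x); rewrite -tclsE; apply/esym/(@reprK _ {eq_quot tensor_eq}). Qed.

Lemma tensor_power_cover (pS : p \in [pchar S]) :
  frobenius_cover p (tinj ord0 \o f : {rmorphism S -> W}).
Proof.
have [[m [t ht]] [e [g [gf gs]]]] := fc.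
pose b := tinj ord0 \o f : {rmorphism S -> W}.
split.
  apply: (@finite_homP _ _ _ {ffun 'I_n.+1 -> 'I_m} (fun u => \prod_i tinj i (t (u i)))) => y.
  have [w ->] := tgen y; elim: w => [|a w [c IH]].
    by exists (fun=> 0); rewrite big_nil big1 // => u _; rewrite rmorph0 mul0r.
  have /choice [d hd] i : exists d : 'I_m -> S, a i = \sum_j f (d j) * t j by apply: ht.
  exists (fun u : {ffun 'I_n.+1 -> 'I_m} => \prod_i d i (u i) + c u).
  rewrite big_cons IH.
  under [RHS]eq_bigr => u _ do rewrite rmorphD mulrDl.
  rewrite [RHS]big_split /=; congr (_ + _).
  under eq_bigr => i _ do rewrite hd rmorph_sum.
  rewrite (bigA_distr_bigA (fun i j => tinj i (f (d i j) * t j))) /=.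
  apply: eq_bigr => u _; rewrite !rmorph_prod -big_split /=.
  by apply: eq_bigr => i _; rewrite rmorphM /= (tinj_compat i ord0).
pose c : cofamily := @Cofamily S (fun=> g) (fun _ _ _ => erefl).
exists e, (tlift c : {rmorphism W -> cf_ring c}); split.
  by move=> x; rewrite /= tlift_inj_E /= gf.
apply: (@frob_inv_spec p S W pS b _ e).
have pW : p \in [pchar W] := rmorph_pchar b pS.
have fi := spec_frob_inv pS gf gs.
pose good (y : W) := exists k, forall j, (k <= j)%N ->
  b (tlift c y) ^+ (p ^ j) = y ^+ (p ^ (e + j)).
have up y k : b (tlift c y) ^+ (p ^ k) = y ^+ (p ^ (e + k)) -> good y.
  move=> h; exists k => j /subnK <-.
  by rewrite [(_ + k)%N]addnC addnA !(expnD _ (_ + _)%N) expnD !exprM h.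
have good0 : good 0.
  apply: (up _ 0%N); have p0 k : (p ^ k == 0)%N = false.
    by apply/negbTE; rewrite -lt0n expn_gt0 prime_gt0 // (pcharf_prime pS).
  by rewrite !rmorph0 !expr0n !p0.
have good1 : good 1 by apply: (up _ 0%N); rewrite !rmorph1 !expr1n.
have goodD x y : good x -> good y -> good (x + y).
  move=> [k hk] [l hl]; exists (maxn k l) => j; rewrite geq_max => /andP[kj lj].
  by rewrite !rmorphD !(exprDp pW) hk ?hl.
have goodM x y : good x -> good y -> good (x * y).
  move=> [k hk] [l hl]; exists (maxn k l) => j; rewrite geq_max => /andP[kj lj].
  by rewrite !rmorphM !exprMn hk ?hl.
have goodi i x : good (tinj i x).
  have [k hk] := fi x; apply: (up _ k).
  by rewrite /= tlift_inj_E /= (tinj_compat ord0 i) -[LHS]rmorphXn -[RHS]rmorphXn hk.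
suff ok y : good y by move=> y; have [k hk] := ok y; exists k; apply: hk.
have [w ->] := tgen y.
by apply: (big_ind good) => // a _; apply: (big_ind good).
Qed.

End TensorPower.

Local Close Scope quotient_scope.
Local Close Scope ring_scope.

(* Coefficient groups of sheaves.  zmodType cannot be used: the colimit over all
   coverings is indexed by a type of rings, hence lives in a universe strictly
   above that of the carriers of the algebraic structures of MathComp. *)
Record abGroup := AbGroup {
  ab_sort :> Type;
  ab0 : ab_sort;
  abD : ab_sort -> ab_sort -> ab_sort;
  abN : ab_sort -> ab_sort;
  abDA : associative abD;
  abDC : commutative abD;
  ab0D : left_id ab0 abD;
  abND : left_inverse ab0 abN abD }.

Arguments ab0 {a}.
Arguments abD {a} x y : rename.
Arguments abN {a} x : rename.

Record abHom (A B : abGroup) := AbHom {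
  ab_fun :> A -> B;
  ab_funD : forall x y, ab_fun (abD x y) = abD (ab_fun x) (ab_fun y) }.

Definition ab_trivial (A : abGroup) : Prop := forall x : A, x = ab0.

HB.instance Definition _ (A : abGroup) :=
  Monoid.isComLaw.Build A ab0 abD (@abDA A) (@abDC A) (@ab0D A).

Section AbTheory.
Variable A : abGroup.
Implicit Types x y z : A.
Lemma abD0 x : abD x ab0 = x. Proof. by rewrite abDC ab0D. Qed.
Lemma abDN x : abD x (abN x) = ab0. Proof. by rewrite abDC abND. Qed.
Lemma abDI x y z : abD x y = abD x z -> y = z.
Proof. by move=> h; rewrite -(ab0D y) -(ab0D z) -(abND x) -!abDA h. Qed.
Lemma abDACA x y z t : abD (abD x y) (abD z t) = abD (abD x z) (abD y t).
Proof. by rewrite -!abDA; congr abD; rewrite !abDA (abDC y). Qed.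
Lemma abNK x : abN (abN x) = x.
Proof. by apply: (@abDI (abN x)); rewrite abDN abND. Qed.
Lemma abN_D x y : abN (abD x y) = abD (abN x) (abN y).
Proof. by apply: (@abDI (abD x y)); rewrite abDN abDACA !abDN ab0D. Qed.
Lemma abN0 : abN ab0 = ab0 :> A.
Proof. by apply: (@abDI ab0); rewrite abDN ab0D. Qed.
End AbTheory.

Lemma ab_fun0 (A B : abGroup) (f : abHom A B) : f ab0 = ab0.
Proof. by apply: (@abDI _ (f ab0)); rewrite -ab_funD ab0D abD0. Qed.
Lemma ab_funN (A B : abGroup) (f : abHom A B) x : f (abN x) = abN (f x).
Proof. by apply: (@abDI _ (f x)); rewrite -ab_funD !abDN ab_fun0. Qed.

(* The abelian group generated by G subject to universal relations: it is initial
   among the abelian groups A with an admissible map G -> A.  Its elements are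
   formal signed sums of generators (true marks a minus sign), identified when
   they have the same value under every admissible map. *)
Section Presentation.
Variables (G : Type) (adm : forall A : abGroup, (G -> A) -> Prop).

Fixpoint signed_sum (A : abGroup) (f : G -> A) (w : seq (bool * G)) : A :=
  if w is (s, g) :: w' then abD (if s then abN (f g) else f g) (signed_sum f w')
  else ab0.

Definition same_sum (w w' : seq (bool * G)) : Prop :=
  forall (A : abGroup) (f : G -> A), adm f -> signed_sum f w = signed_sum f w'.

Definition pres_sort := {P : seq (bool * G) -> Prop | exists w, P = same_sum w}.

Definition pres_cls (w : seq (bool * G)) : pres_sort :=
  exist _ (same_sum w) (ex_intro _ w erefl).

Definition pres_repr (x : pres_sort) : seq (bool * G) := projT1 (cid (projT2 x)).

Lemma pres_reprK x : pres_cls (pres_repr x) = x.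
Proof.
rewrite /pres_repr; case: x => P h /=; case: cid => w /= e.
by apply: eq_exist.
Qed.

Lemma pres_cls_eq w w' : same_sum w w' -> pres_cls w = pres_cls w'.
Proof.
move=> h; apply: eq_exist; apply: funext => v; apply: propext.
by split=> h' A f af; rewrite -h' // h.
Qed.

Lemma pres_cls_same w w' : pres_cls w = pres_cls w' -> same_sum w w'.
Proof. by move=> [e]; rewrite e. Qed.

Definition pres_eval (A : abGroup) (f : G -> A) (x : pres_sort) : A :=
  signed_sum f (pres_repr x).

Lemma pres_evalE A f w : @adm A f -> pres_eval f (pres_cls w) = signed_sum f w.
Proof. by move=> af; apply: (pres_cls_same (pres_reprK _)). Qed.

Lemma pres_ext x y : (forall A f, @adm A f -> pres_eval f x = pres_eval f y) -> x = y.
Proof.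
by move=> h; rewrite -(pres_reprK x) -(pres_reprK y); apply: pres_cls_eq => A f /h.
Qed.

Definition pres_add x y := pres_cls (pres_repr x ++ pres_repr y).
Definition pres_opp x := pres_cls [seq (~~ sg.1, sg.2) | sg <- pres_repr x].

Lemma pres_eval_add A f x y : @adm A f ->
  pres_eval f (pres_add x y) = abD (pres_eval f x) (pres_eval f y).
Proof.
move=> af; rewrite pres_evalE // /pres_eval.
elim: (pres_repr x) => [|[s g] w IH] /=; first by rewrite ab0D.
by rewrite IH abDA.
Qed.

Lemma pres_eval_opp A f x : @adm A f ->
  pres_eval f (pres_opp x) = abN (pres_eval f x).
Proof.
move=> af; rewrite pres_evalE // /pres_eval.
elim: (pres_repr x) => [|[s g] w IH] /=; first by rewrite abN0.
by rewrite IH abN_D; case: s; rewrite /= ?abNK.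
Qed.

Lemma pres_addA : associative pres_add.
Proof. by move=> x y z; apply: pres_ext => A f af; rewrite !pres_eval_add // abDA. Qed.
Lemma pres_addC : commutative pres_add.
Proof. by move=> x y; apply: pres_ext => A f af; rewrite !pres_eval_add // abDC. Qed.
Lemma pres_add0 : left_id (pres_cls [::]) pres_add.
Proof.
by move=> x; apply: pres_ext => A f af; rewrite !pres_eval_add // pres_evalE //= ab0D.
Qed.
Lemma pres_addN : left_inverse (pres_cls [::]) pres_opp pres_add.
Proof.
move=> x; apply: pres_ext => A f af.
by rewrite !pres_eval_add // pres_eval_opp // pres_evalE //= abND.
Qed.

Definition presented : abGroup := AbGroup pres_addA pres_addC pres_add0 pres_addN.

Definition pres_gen (g : G) : presented := pres_cls [:: (false, g)].

Definition pres_lift (A : abGroup) (f : G -> A) (af : adm f) : abHom presented A :=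
  @AbHom presented A (pres_eval f) (fun x y => pres_eval_add x y af).

Lemma pres_liftE A f (af : @adm A f) g : pres_lift af (pres_gen g) = f g.
Proof. by rewrite /= pres_evalE //= abD0. Qed.

Lemma pres_hom_ext (A : abGroup) (h k : abHom presented A) :
  (forall g, h (pres_gen g) = k (pres_gen g)) -> h =1 k.
Proof.
move=> hk x; rewrite -(pres_reprK x); elim: (pres_repr x) => [|[s g] w IH].
  by rewrite -/(@ab0 presented) !ab_fun0.
have -> : pres_cls ((s, g) :: w) =
    abD (if s then abN (pres_gen g) else pres_gen g) (pres_cls w) :> presented.
  apply: pres_ext => A' f af; rewrite pres_eval_add // !pres_evalE //=.
  by case: s; rewrite /= ?pres_eval_opp // !pres_evalE //= abD0.
by rewrite !ab_funD IH; case: s; rewrite ?ab_funN hk.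
Qed.

End Presentation.

(* M (x)_R S as an abelian group, S being an R-algebra via a. *)
Section TensorModule.
Variables (R : comNzRingType) (M : lmodType R) (S : comNzRingType) (a : {rmorphism R -> S}).

Definition balanced (A : abGroup) (f : M * S -> A) : Prop :=
  [/\ forall m m' s, f ((m + m')%R, s) = abD (f (m, s)) (f (m', s)),
      forall m s s', f (m, (s + s')%R) = abD (f (m, s)) (f (m, s')) &
      forall r m s, f ((r *: m)%R, s) = f (m, (a r * s)%R)].

Definition tensor_module : abGroup := presented balanced.
Definition tensor (m : M) (s : S) : tensor_module := pres_gen balanced (m, s).

Lemma tensor_balanced : balanced (fun ms => tensor ms.1 ms.2).
Proof.
by split=> *; apply: pres_ext => A f af; case: (af) => h1 h2 h3;
   rewrite ?pres_eval_add // !pres_evalE //= !abD0.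
Qed.
End TensorModule.

Section TensorModuleMap.
Variables (R : comNzRingType) (M : lmodType R) (S S' : comNzRingType)
  (a : {rmorphism R -> S}) (a' : {rmorphism R -> S'}) (h : {rmorphism S -> S'}).
Hypothesis ha : forall r, h (a r) = a' r.

Lemma tensor_map_subproof : balanced a (fun ms : M * S => tensor a' ms.1 (h ms.2)).
Proof.
have [h1 h2 h3] := tensor_balanced M a'.
split=> [m m' s|m s s'|r m s] /=; first exact: (h1 m m' (h s)).
  by rewrite rmorphD; apply: (h2 m (h s) (h s')).
by rewrite rmorphM ha; apply: (h3 r m (h s)).
Qed.

Definition tensor_map : abHom (tensor_module M a) (tensor_module M a') :=
  pres_lift tensor_map_subproof.

Lemma tensor_mapE m s : tensor_map (tensor a m s) = tensor a' m (h s).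
Proof. exact: (pres_liftE tensor_map_subproof (m, s)). Qed.
End TensorModuleMap.

Section Homology.
Variables (C : nat -> abGroup) (d : forall n, abHom (C n) (C n.+1)).

Definition cocycle (k : nat) := {x : C k | d k x = ab0}.

Definition coboundary (k : nat) : C k -> Prop :=
  match k with
  | 0 => fun x => x = ab0
  | k'.+1 => fun x => exists y, x = d k' y
  end.

(* Cocycles modulo coboundaries. *)
Definition homology_rel (k : nat) (A : abGroup) (f : cocycle k -> A) : Prop :=
  (forall x y z, sval z = abD (sval x) (sval y) -> f z = abD (f x) (f y)) /\
  (forall z, coboundary (sval z) -> f z = ab0).

Definition homology (k : nat) : abGroup := presented (@homology_rel k).
End Homology.

Section HomologyMap.
Variables (C C' : nat -> abGroup).
Variables (d : forall n, abHom (C n) (C n.+1)) (d' : forall n, abHom (C' n) (C' n.+1)).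
Variable (u : forall n, abHom (C n) (C' n)).
Hypothesis ud : forall n x, u n.+1 (d n x) = d' n (u n x).

Definition cocycle_map k (x : cocycle d k) : cocycle d' k.
Proof. by exists (u k (sval x)); rewrite -ud (svalP x) ab_fun0. Defined.

Lemma homology_map_subproof k :
  homology_rel (fun x : cocycle d k => pres_gen (@homology_rel C' d' k) (cocycle_map x)).
Proof.
split=> [x y z e|z hz]; apply: pres_ext => A f af; have [fD fB] := af.
  rewrite pres_eval_add // !pres_evalE //= !abD0; apply: fD.
  by rewrite /= e ab_funD.
rewrite !pres_evalE //= abD0; apply: fB => /=.
case: z hz => /= z _; case: k z {f af fD} => [|k] z /=.
  by move=> ->; rewrite ab_fun0.
by move=> [y ->]; exists (u k y); rewrite ud.
Qed.

Definition homology_map k : abHom (homology d k) (homology d' k) :=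
  pres_lift (homology_map_subproof k).
End HomologyMap.

Section Site.
Variables (p : nat) (R : comNzRingType).

(* The objects of X_frob: finite Frobenius covers of X = Spec R. *)
Record frob_site := FrobSite {
  fs_ring :> comNzRingType;
  fs_str : {rmorphism R -> fs_ring};
  fs_cover : frobenius_cover p fs_str }.

(* Morphisms Spec V -> Spec U over X, given by ring maps U -> V.  Each of them,
   on its own, is a covering of its target. *)
Record frob_hom (V U : frob_site) := FrobHom {
  fh_ring :> {rmorphism U -> V};
  fh_over : forall r, fh_ring (fs_str U r) = fs_str V r;
  fh_cover : frobenius_cover p fh_ring }.

Lemma rmorphism_ext (A B : comNzRingType) (f g : {rmorphism A -> B}) : f =1 g -> f = g.
Proof.
case: f => f [[a1] [a2]]; case: g => g [[b1] [b2]] /= /funext e.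
move: a1 a2 b1 b2; rewrite e => a1 a2 b1 b2.
by congr (GRing.RMorphism.Pack (GRing.RMorphism.Class _ _)); congr (_ _); apply: Prop_irrelevance.
Qed.

Lemma frob_hom_ext (V U : frob_site) (f g : frob_hom V U) : f =1 g -> f = g.
Proof.
case: f => f a b; case: g => g c d /= /rmorphism_ext e.
by move: a b; rewrite e => a b; congr FrobHom; apply: Prop_irrelevance.
Qed.

Definition frob_id (U : frob_site) : frob_hom U U :=
  @FrobHom U U idfun (fun _ => erefl) (frobenius_cover_id p U).

Lemma frob_comp_over (W V U : frob_site) (f : frob_hom V U) (g : frob_hom W V) r :
  (g \o f) (fs_str U r) = fs_str W r.
Proof. by rewrite /= !fh_over. Qed.

(* Composition of morphisms of schemes: f after g. *)
Definition frob_comp (W V U : frob_site) (f : frob_hom V U) (g : frob_hom W V) :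
    frob_hom W U :=
  @FrobHom W U (g \o f) (frob_comp_over f g)
    (frobenius_cover_comp (fh_cover f) (fh_cover g)).

Definition frob_top : frob_site := @FrobSite R idfun (frobenius_cover_id p R).

Definition frob_struct (U : frob_site) : frob_hom U frob_top :=
  @FrobHom U frob_top (fs_str U) (fun _ => erefl) (fs_cover U).

Record presheaf := Presheaf {
  sec :> frob_site -> abGroup;
  res : forall V U : frob_site, frob_hom V U -> abHom (sec U) (sec V);
  res_id : forall U s, res (frob_id U) s = s;
  res_comp : forall (W V U : frob_site) (f : frob_hom V U) (g : frob_hom W V) s,
    res (frob_comp f g) s = res g (res f s) }.

Record presheaf_hom (F G : presheaf) := PresheafHom {
  ph_fun :> forall U, abHom (F U) (G U);
  ph_nat : forall (V U : frob_site) (f : frob_hom V U) s,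
    ph_fun V (res F f s) = res G f (ph_fun U s) }.

Section ModulePresheaf.
Variable M : lmodType R.

(* The presheaf Spec S |-> M (x)_R S. *)
Definition module_sec (U : frob_site) : abGroup := tensor_module M (fs_str U).
Definition module_res (V U : frob_site) (f : frob_hom V U) :
    abHom (module_sec U) (module_sec V) :=
  tensor_map M (fh_over f).

Lemma module_res_id U s : module_res (frob_id U) s = s.
Proof.
pose i : abHom (module_sec U) (module_sec U) := @AbHom (module_sec U) (module_sec U) id (fun _ _ => erefl).
apply: (pres_hom_ext (k := i)) => -[m t]; exact: tensor_mapE.
Qed.

Lemma module_res_comp (W V U : frob_site) (f : frob_hom V U) (g : frob_hom W V) s :
  module_res (frob_comp f g) s = module_res g (module_res f s).
Proof.
have cD x y : module_res g (module_res f (abD x y)) =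
    abD (module_res g (module_res f x)) (module_res g (module_res f y)).
  by rewrite !ab_funD.
pose c := AbHom cD.
apply: (pres_hom_ext (k := c)) => -[m t].
have e1 := tensor_mapE (fh_over (frob_comp f g)) m t.
have e2 := tensor_mapE (fh_over f) m t.
have e3 := tensor_mapE (fh_over g) m (f t).
exact: (etrans e1 (esym (etrans (congr1 (module_res g) e2) e3))).
Qed.

Definition module_presheaf : presheaf := Presheaf module_res_id module_res_comp.
End ModulePresheaf.

Variable pR : p \in [pchar R]%R.

Section FibrePower.
Variables (V U : frob_site) (f : frob_hom V U) (n : nat).

Lemma fs_pchar (W : frob_site) : p \in [pchar W]%R.
Proof. exact (rmorph_pchar (fs_str W) pR). Qed.

Definition fibre_power_base : {rmorphism U -> tensor_power n (fh_cover f)} :=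
  tinj (fh_cover f) ord0 \o f.

(* The (n+1)-fold fibre product V x_U ... x_U V, with its projections fibre_proj
   and its universal property fibre_lift. *)
Definition fibre_power : frob_site :=
  @FrobSite (tensor_power n (fh_cover f)) (fibre_power_base \o fs_str U)
    (frobenius_cover_comp (fs_cover U) (tensor_power_cover n (fh_cover f) (fs_pchar U))).

(* Any morphism over X between objects of the site is a finite Frobenius cover. *)
Definition frob_hom_of (X Y : frob_site) (h : {rmorphism Y -> X})
    (hY : forall r, h (fs_str Y r) = fs_str X r) : frob_hom X Y :=
  FrobHom hY (alg_hom_cover pR (fs_cover Y) (fs_cover X) hY).

Lemma fibre_proj_over i r : tinj (fh_cover f) i (fs_str V r) = fs_str fibre_power r.
Proof. by rewrite -(fh_over f) (tinj_compat _ i ord0). Qed.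

Definition fibre_proj (i : 'I_n.+1) : frob_hom fibre_power V :=
  @frob_hom_of fibre_power V (tinj (fh_cover f) i) (fibre_proj_over i).

Section Lift.
Variables (W : frob_site) (h : 'I_n.+1 -> frob_hom W V).
Hypothesis hf : forall i j, frob_comp f (h i) = frob_comp f (h j).

Lemma fibre_lift_compat i j s : h i (f s) = h j (f s).
Proof. exact: (congr1 (fun k : frob_hom W U => k s) (hf i j)). Qed.

Definition fibre_cofamily : cofamily f n := Cofamily fibre_lift_compat.

Lemma fibre_lift_over r : tlift fibre_cofamily (fs_str fibre_power r) = fs_str W r.
Proof. by rewrite /= tlift_inj_E /= !fh_over. Qed.

Definition fibre_lift : frob_hom W fibre_power :=
  @frob_hom_of W fibre_power
    (tlift fibre_cofamily :
       {rmorphism tensor_power n (fh_cover f) -> cf_ring fibre_cofamily})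
    fibre_lift_over.

Lemma fibre_liftE i : frob_comp (fibre_proj i) fibre_lift = h i.
Proof. by apply: frob_hom_ext => x /=; rewrite tlift_inj_E. Qed.
End Lift.

Lemma fibre_proj_compat i j :
  frob_comp f (fibre_proj i) = frob_comp f (fibre_proj j).
Proof. by apply: frob_hom_ext => s /=; rewrite (tinj_compat _ i j). Qed.

Lemma fibre_hom_ext W (g g' : frob_hom W fibre_power) :
  (forall i, frob_comp (fibre_proj i) g = frob_comp (fibre_proj i) g') -> g = g'.
Proof.
move=> h; apply: frob_hom_ext => x.
have [w ->] := tgen x; rewrite !rmorph_sum; apply: eq_bigr => a _.
rewrite !rmorph_prod; apply: eq_bigr => i _.
exact: (congr1 (fun k : frob_hom W V => k (a i)) (h i)).
Qed.
End FibrePower.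

(* Exactness of F U -> F V => F (V x_U V) for the coverings f : V -> U. *)
Definition is_sheaf (F : presheaf) : Prop :=
  forall (V U : frob_site) (f : frob_hom V U) (s : F V),
    res F (fibre_proj f (n := 1) ord0) s = res F (fibre_proj f (n := 1) ord_max) s ->
    exists! t : F U, res F f t = s.

(* eta is the universal morphism from P to a sheaf. *)
Definition is_sheafification (P F : presheaf) (eta : presheaf_hom P F) : Prop :=
  is_sheaf F /\
  forall (G : presheaf) (theta : presheaf_hom P G), is_sheaf G ->
    exists theta' : presheaf_hom F G,
      (forall U s, theta' U (eta U s) = theta U s) /\
      forall theta'' : presheaf_hom F G,
        (forall U s, theta'' U (eta U s) = theta U s) ->
        forall U s, theta'' U s = theta' U s.

Section Cech.
Variable F : presheaf.

(* The projection omitting the i-th factor. *)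
Definition coface (V U : frob_site) (f : frob_hom V U) (n : nat) (i : 'I_n.+2) :
    frob_hom (fibre_power f n.+1) (fibre_power f n) :=
  fibre_lift (fun a b => fibre_proj_compat f (lift i a) (lift i b)).

Section FibreMap.
Variables (V' V U : frob_site) (f' : frob_hom V' U) (f : frob_hom V U) (g : frob_hom V' V).
Hypothesis fg : frob_comp f g = f'.

Lemma fibre_map_subproof n (i j : 'I_n.+1) :
  frob_comp f (frob_comp g (fibre_proj f' i)) = frob_comp f (frob_comp g (fibre_proj f' j)).
Proof.
have fgE x : g (f x) = f' x by rewrite -fg.
by apply: frob_hom_ext => s /=; rewrite fgE (tinj_compat _ i j).
Qed.

Definition fibre_map n : frob_hom (fibre_power f' n) (fibre_power f n) :=
  fibre_lift (@fibre_map_subproof n).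

Lemma fibre_map_coface n i :
  frob_comp (coface f i) (fibre_map n.+1) = frob_comp (fibre_map n) (coface f' i).
Proof.
apply: fibre_hom_ext => j; apply: frob_hom_ext => x /=.
by do 4?rewrite tlift_inj_E /=.
Qed.
End FibreMap.

Definition cech_cochain (V U : frob_site) (f : frob_hom V U) (n : nat) : abGroup :=
  F (fibre_power f n).

Section Cochain.
Variables (V U : frob_site) (f : frob_hom V U).

Definition cech_term n (i : 'I_n.+2) (x : cech_cochain f n) : cech_cochain f n.+1 :=
  if odd i then abN (res F (coface f i) x) else res F (coface f i) x.

Definition cech_diff_fun n (x : cech_cochain f n) : cech_cochain f n.+1 :=
  \big[abD/ab0]_(i < n.+2) cech_term i x.

Lemma cech_diffD n x y :
  cech_diff_fun (abD x y) = abD (cech_diff_fun (n := n) x) (cech_diff_fun y).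
Proof.
rewrite /cech_diff_fun -big_split; apply: eq_bigr => i _.
by rewrite /cech_term ab_funD; case: odd; rewrite ?abN_D.
Qed.

Definition cech_diff n : abHom (cech_cochain f n) (cech_cochain f n.+1) := AbHom (@cech_diffD n).
End Cochain.

Lemma cech_map_diff (V' V U : frob_site) (f' : frob_hom V' U) (f : frob_hom V U)
    (g : frob_hom V' V) (fg : frob_comp f g = f') n (x : cech_cochain f n) :
  res F (fibre_map fg n.+1) (cech_diff f n x) = cech_diff f' n (res F (fibre_map fg n) x).
Proof.
rewrite /= /cech_diff_fun (big_morph _ (ab_funD (res F _)) (ab_fun0 (res F _))).
apply: eq_bigr => i _; rewrite /cech_term.
by case: odd; rewrite ?ab_funN -!res_comp fibre_map_coface.
Qed.

Definition cech_homology (Y : frob_site) (k : nat) : abGroup :=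
  homology (cech_diff (frob_struct Y)) k.

Lemma frob_struct_comp (Y' Y : frob_site) (g : frob_hom Y' Y) :
  frob_comp (frob_struct Y) g = frob_struct Y'.
Proof. by apply: frob_hom_ext => r /=; rewrite fh_over. Qed.

Definition cech_refine (Y' Y : frob_site) (g : frob_hom Y' Y) (k : nat) :
    abHom (cech_homology Y k) (cech_homology Y' k) :=
  homology_map (cech_map_diff (frob_struct_comp g)) k.

(* The colimit of the groups cech_homology Y k over all coverings Y -> X and all
   refinements Y' -> Y. *)
Definition cech_elt (k : nat) := {Y : frob_site & cech_homology Y k}.
Definition cech_at (k : nat) (Y : frob_site) (x : cech_homology Y k) : cech_elt k :=
  existT (fun Y => ab_sort (cech_homology Y k)) Y x.

Definition cech_cocone (k : nat) (A : abGroup) (u : cech_elt k -> A) : Prop :=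
  (forall Y (x y : cech_homology Y k),
     u (cech_at (abD x y)) = abD (u (cech_at x)) (u (cech_at y))) /\
  (forall (Y' Y : frob_site) (g : frob_hom Y' Y) (x : cech_homology Y k),
     u (cech_at (cech_refine g k x)) = u (cech_at x)).

Definition cech_cohomology (k : nat) : abGroup := presented (@cech_cocone k).

End Cech.

Definition injective_map (F G : presheaf) (u : presheaf_hom F G) : Prop :=
  forall U, injective (u U).

(* Exactness as sheaves: kernel elements lift locally. *)
Definition exact_at (F G H : presheaf) (u : presheaf_hom F G) (v : presheaf_hom G H) : Prop :=
  (forall U s, v U (u U s) = ab0) /\
  (forall (U : frob_site) (s : G U), v U s = ab0 ->
     exists (V : frob_site) (f : frob_hom V U) (t : F V), u V t = res G f s).

Definition injective_sheaf (I : presheaf) : Prop :=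
  is_sheaf I /\
  forall (A B : presheaf) (i : presheaf_hom A B) (u : presheaf_hom A I),
    is_sheaf A -> is_sheaf B -> injective_map i ->
    exists v : presheaf_hom B I, forall U s, v U (i U s) = u U s.

Record injective_resolution (F : presheaf) := InjectiveResolution {
  ir_obj :> nat -> presheaf;
  ir_aug : presheaf_hom F (ir_obj 0);
  ir_diff : forall n, presheaf_hom (ir_obj n) (ir_obj n.+1);
  ir_injective : forall n, injective_sheaf (ir_obj n);
  ir_aug_injective : injective_map ir_aug;
  ir_exact0 : exact_at ir_aug (ir_diff 0);
  ir_exact : forall n, exact_at (ir_diff n) (ir_diff n.+1) }.

(* H^k(X, F), computed from global sections of an injective resolution. *)
Definition derived_cohomology (F : presheaf) (I : injective_resolution F) (k : nat) : abGroup :=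
  homology (C := fun n => I n frob_top) (fun n => ir_diff I n frob_top) k.

End Site.

(* Main.v *)
Require Import Defs.
From mathcomp Require Import all_boot ssralg.

Import GRing.Theory.
Local Open Scope ring_scope.

(* Every sheaf F on the Frobenius site is constant.  A cover f : V -> U that is
   a closed immersion is a monomorphism, so the gluing condition is vacuous and
   F U -> F V is bijective.  For an arbitrary cover, the diagonal
   V -> V x_U V is such a closed immersion; it equalizes the two restrictions
   F V => F (V x_U V), which therefore coincide, and again F U -> F V is
   bijective.  Hence every Cech complex is A -0-> A -1-> A -0-> A -1-> ... with
   A = F X, and exactness of sheaves is exactness on global sections. *)

(** Formal sums are identified by their values under admissible maps, so if these kill the
    generators, every sum equals the empty one. *)
Lemma pres_trivial (G : Type) (adm : forall A : abGroup, (G -> A) -> Prop) :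
  (forall g (A : abGroup) (f : G -> A), adm A f -> f g = ab0) ->
  ab_trivial (presented adm).
Proof.
move=> h x; rewrite -(pres_reprK x); apply: pres_cls_eq => A f af /=.
elim: (pres_repr x) => [//|[s g] w /= ->].
by rewrite (h g A f af) abN0 if_same abD0.
Qed.

Lemma homology_trivial (C : nat -> abGroup) (d : forall n, abHom (C n) (C n.+1)) k :
  (forall x : C k, d k x = ab0 -> coboundary d x) -> ab_trivial (homology d k).
Proof.
by move=> h; apply: pres_trivial => -[x dx] A f [_ fB]; apply: fB; apply: h.
Qed.

Lemma alternating_sum (A : abGroup) (a : A) n :
  \big[abD/ab0]_(i < n) (if odd i then abN a else a) = if odd n then a else ab0.
Proof.
elim: n => [|n IH]; first by rewrite big_ord0.
by rewrite big_ord_recr /= IH; case: (odd n); rewrite /= ?abDN ?ab0D.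
Qed.

Section FrobeniusSheaf.
Variables (p : nat) (R : comNzRingType) (pR : p \in [pchar R]).
Variables (F : presheaf p R) (sF : is_sheaf pR F).

(** Every section over [V] glues: existence gives surjectivity, uniqueness injectivity. *)
Lemma res_bij_of_proj (V U : frob_site p R) (f : frob_hom V U) :
  (forall s : F V, res F (fibre_proj pR f (n := 1) ord0) s =
                   res F (fibre_proj pR f (n := 1) ord_max) s) ->
  injective (res F f) /\ forall s, exists t, res F f t = s.
Proof.
move=> h; split=> [t t' e|s].
  by have [u [_ hu]] := sF _ _ f _ (h (res F f t)); rewrite -(hu t) // -(hu t').
by have [t [ht _]] := sF _ _ f _ (h s); exists t.
Qed.

Lemma res_inj_of_surj (V U : frob_site p R) (f : frob_hom V U) :
  (forall y, exists x, f x = y) -> injective (res F f).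
Proof.
move=> f_surj; apply: (proj1 (@res_bij_of_proj V U f _)) => s; congr (res F _ s).
(* Both projections agree on the image of [f], which is everything. *)
apply: frob_hom_ext => y; have [x <-] := f_surj y.
exact: (congr1 (fun k : frob_hom _ U => k x) (fibre_proj_compat pR f ord0 ord_max)).
Qed.

Lemma res_bij (V U : frob_site p R) (f : frob_hom V U) :
  injective (res F f) /\ forall s, exists t, res F f t = s.
Proof.
(* On rings [diag] is multiplication; a coprojection is a right inverse, so it is surjective. *)
pose diag := @fibre_lift p R pR V U f 1 V (fun=> frob_id V) (fun _ _ => erefl).
have diagE i : frob_comp (fibre_proj pR f i) diag = frob_id V by apply: fibre_liftE.
apply: res_bij_of_proj => s; apply: (@res_inj_of_surj _ _ diag).
  move=> y; exists (fibre_proj pR f ord0 y).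
  exact: (congr1 (fun k : frob_hom V V => k y) (diagE ord0)).
by rewrite -!res_comp !diagE.
Qed.

Lemma res_struct_inj (U : frob_site p R) : injective (res F (frob_struct U)).
Proof. exact: (proj1 (res_bij _ _ _)). Qed.

Lemma res_struct_surj (U : frob_site p R) (s : F U) :
  exists a, res F (frob_struct U) a = s.
Proof. exact: (proj2 (res_bij _ _ (frob_struct U)) s). Qed.

Lemma cech_diff_struct (V : frob_site p R) n (a : F (frob_top p R)) :
  cech_diff pR F (frob_struct V) n (res F (frob_struct _) a) =
  if odd n then res F (frob_struct _) a else ab0.
Proof.
(* There are [n.+2] cofaces, whose terms agree up to sign; hence the passage from [odd n] to
   [odd n.+2]. *)
rewrite -[odd n]negbK -[~~ odd n]/(odd n.+1) -[~~ _]/(odd n.+2) -alternating_sum /=.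
by apply: eq_bigr => i _; rewrite /cech_term -!res_comp !frob_struct_comp.
Qed.

Lemma cech_homology_trivial (V : frob_site p R) k :
  (0 < k)%N -> ab_trivial (cech_homology pR F V k).
Proof.
case: k => // k _; apply: homology_trivial => x.
have [a <-] := res_struct_surj _ x.
move=> /(etrans (esym (cech_diff_struct V k.+1 a))) da.
have := cech_diff_struct V k a; move: da => /=.
(* For odd [k] the incoming differential fixes the global section [a]; for even [k] the outgoing one
   does, which forces [a] to vanish. *)
case: (odd k) => /= [_ da|da _]; first by exists (res F (frob_struct _) a).
have -> : a = ab0 by exact: (res_struct_inj _ _ _ (etrans da (esym (ab_fun0 _)))).
exists ab0; rewrite ab_fun0.
exact: (esym (ab_fun0 (cech_diff pR F (frob_struct V) k))).
Qed.

Lemma cech_cohomology_trivial k : (0 < k)%N -> ab_trivial (cech_cohomology pR F k).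
Proof.
move=> k_gt0; apply: pres_trivial => -[V x] A u [uD _].
have x0 := cech_homology_trivial V k k_gt0 x.
(* Both [x] and its double are zero, so additivity says that the value of [u] there equals its own
   double. *)
have := uD V x x; rewrite [abD x x](cech_homology_trivial V k k_gt0) x0 -{1}[u _]abD0.
by move/abDI => {1}->.
Qed.

End FrobeniusSheaf.

Lemma sheaf_exact_top (p : nat) (R : comNzRingType) (pR : p \in [pchar R])
    (F G H : presheaf p R) (u : presheaf_hom F G) (v : presheaf_hom G H) :
  is_sheaf pR F -> is_sheaf pR G -> exact_at u v ->
  forall s : G (frob_top p R), v _ s = ab0 -> exists t, s = u _ t.
Proof.
move=> sF sG [_ uv] s /uv [V [f [t ut]]].
(* The local lift [t] descends by surjectivity for [F]; that [t0] maps to [s] may be checked on [V]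
   by injectivity for [G]. *)
have [t0 t0E] := proj2 (res_bij _ _ _ _ sF _ _ f) t; exists t0.
by apply: (proj1 (res_bij _ _ _ _ sG _ _ f)); rewrite -ph_nat t0E ut.
Qed.

Theorem proposition4p5p1 (K : fieldType) (R : comNzRingType) (p : nat)
    (hp : p \in [pchar K]) (iota : {rmorphism K -> R}) (M : lmodType R)
    (Mfrob : presheaf p R) (eta : presheaf_hom (module_presheaf p M) Mfrob) :
  let pR : p \in [pchar R] := rmorph_pchar iota hp in
  is_sheafification pR eta ->
  (forall k : nat, (1 <= k)%N -> ab_trivial (cech_cohomology pR Mfrob k)) /\
  (forall I : injective_resolution pR Mfrob, ab_trivial (derived_cohomology I 1)).
Proof.
move=> pR [sM _]; split=> [k|I]; first exact: cech_cohomology_trivial.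
(* A coboundary in degree one is a global section that lifts along [ir_diff I 0], so exactness at
   [I 1] is what is needed. *)
apply: homology_trivial.
have sI n := proj1 (ir_injective I n).
exact: (@sheaf_exact_top _ _ pR _ _ _ _ _ (sI 0%N) (sI 1%N) (ir_exact I 0)).
Qed.
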